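(* Let $r\geq 3$ and let $g'$ be an even integer. Assume there is an $r$-regular graph of girth $g'$ which is Hamiltonian and has exactly $n_0(r,g')=2\sum_{i=0}^{g'/2-1}(r-1)^i$ vertices. Then there exists an integer $g$ with $g'+1\leq g\leq \frac{3}{2}g'-1$ such that $n(2,r-2,g)\leq n_0(r,g')$.
   Context: A weighted graph (wgraph) is a pair $G=(L,H)$ of simple finite graphs with $V(L)=V(H)$ and $E(L)\cap E(H)=\varnothing$; edges of $L$ are light (weight 1) and edges of $H$ are heavy (weight 2). A wcycle is a cycle (of length at least 3) in the graph with edge set $E(L)\cup E(H)$; its weight is the sum of the weights of its edges. The girth of $G$ is the minimum weight of a wcycle. $G$ is $(a,b)$-regular if $L$ is $a$-regular and $H$ is $b$-regular. An $(a,b,g)$-wgraph is an $(a,b)$-regular wgraph of girth $g$; $n(a,b,g)$ is the minimum order of an $(a,b,g)$-wgraph ($\infty$ if none exists). *)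

(* Defs.v *)
From HB Require Import structures.
From mathcomp Require Import all_boot all_order all_algebra.
From mathcomp Require Import boolp classical_sets constructive_ereal.

Set Implicit Arguments.
Unset Strict Implicit.
Unset Printing Implicit Defensive.

Local Open Scope nat_scope.

(* The least element of A, with the convention that it is +oo for empty A. *)
Definition min_nat (A : set nat) : \bar int :=
  if pselect (exists n, `[< A n >]) is left exA
  then (Posz (ex_minn exA))%:E else +oo%E.

Record sgraph (T : finType) := SGraph {
  adj :> rel T;
  adj_sym : symmetric adj;
  adj_irrefl : irreflexive adj }.

Definition regular (T : finType) (k : nat) (G : sgraph T) : Prop :=
  forall x : T, #|[set y | G x y]| = k.

(* A cycle is represented by the sequence of its vertices in cyclic order, so *)
(* its length is the size of the sequence.                                    *)
Definition graph_cycle (T : finType) (e : rel T) (c : seq T) : bool :=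
  [&& 2 < size c, uniq c & cycle e c].

Definition girth (T : finType) (G : sgraph T) : \bar int :=
  min_nat [set n | exists2 c : seq T, graph_cycle G c & size c = n].

Definition hamiltonian (T : finType) (G : sgraph T) : Prop :=
  exists2 c : seq T, graph_cycle G c & forall x : T, x \in c.

Record wgraph (T : finType) := WGraph {
  light : sgraph T;
  heavy : sgraph T;
  light_heavy_disjoint : forall x y, ~~ (light x y && heavy x y) }.

Definition wadj (T : finType) (G : wgraph T) : rel T :=
  [rel x y | light G x y || heavy G x y].

Definition wcycle (T : finType) (G : wgraph T) (c : seq T) : bool :=
  graph_cycle (wadj G) c.

(* The edges of the cycle c are the pairs {x, next c x}; the booleans are     *)
(* coerced to 0 or 1.                                                         *)
Definition wcycle_weight (T : finType) (G : wgraph T) (c : seq T) : nat :=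
  \sum_(x <- c) (1 * light G x (next c x) + 2 * heavy G x (next c x)).

Definition wgirth (T : finType) (G : wgraph T) : \bar int :=
  min_nat [set w | exists2 c : seq T, wcycle G c & wcycle_weight G c = w].

Definition wregular (T : finType) (a b : nat) (G : wgraph T) : Prop :=
  regular a (light G) /\ regular b (heavy G).

Definition abg_wgraph (T : finType) (a b g : nat) (G : wgraph T) : Prop :=
  wregular a b G /\ wgirth G = (Posz g)%:E.

Definition min_order (a b g : nat) : \bar int :=
  min_nat [set n | exists (T : finType) (G : wgraph T),
                     abg_wgraph a b g G /\ #|T| = n].

Definition n0 (r g' : nat) : nat := 2 * \sum_(0 <= i < g'./2) (r - 1) ^ i.

(* Main.v *)
(* Make the edges of a Hamiltonian cycle h light and all the others heavy, and *)
(* put m = g'/2. A wcycle weighs its length plus its number of heavy edges, so *)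
(* weight at most g' would force it to have light edges only, hence to be h,   *)
(* which is longer than g'. Conversely, take a path of m + 1 edges along h. As *)
(* the order meets the Moore bound, every vertex is within distance m - 1 of   *)
(* one end of any given edge, and the path is completed by at most m - 1 edges *)
(* to a cycle of length g', whose weight is at most 2m + (m - 1) = 3m - 1.     *)

Require Import Defs.
From mathcomp Require Import all_boot all_order all_algebra.
From mathcomp Require Import boolp classical_sets constructive_ereal.
From mathcomp Require Import zify.

Set Implicit Arguments.
Unset Strict Implicit.
Unset Printing Implicit Defensive.

Local Open Scope nat_scope.

(** * Least elements of sets of naturals *)

Lemma min_nat_attained (A : set nat) (k : nat) :
  A k -> exists n, [/\ min_nat A = (Posz n)%:E, A n & n <= k].
Proof.
move=> Ak; rewrite /min_nat; case: pselect => [exA|]; last first.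
  by case; exists k; apply/asboolP.
case: ex_minnP => n /asboolP An min_n; exists n; split => //.
by apply: min_n; apply/asboolP.
Qed.

Lemma min_nat_fin (A : set nat) (n : nat) :
  min_nat A = (Posz n)%:E -> A n /\ forall k, A k -> n <= k.
Proof.
move=> mA; have inA k : A k -> A n /\ n <= k.
  by case/min_nat_attained=> j []; rewrite mA => -[->].
split; last by move=> k /inA [].
move: mA; rewrite /min_nat; case: pselect => // -[k Ak] _.
by case: (inA k) => //; apply/asboolP.
Qed.

(** * Non-backtracking walks and the cycles they force *)

Section Walks.

Variables (T : finType) (G : sgraph T).

Fixpoint nonbacktracking (s : seq T) : bool :=
  if s is x :: s' then (Some x != ohead (behead s')) && nonbacktracking s'
  else true.

Definition nb_walk (s : seq T) : bool := sorted G s && nonbacktracking s.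

Lemma nb_walk_behead (x : T) (s : seq T) : nb_walk (x :: s) -> nb_walk s.
Proof. by case/andP=> /path_sorted ss /andP [_ nbs]; rewrite /nb_walk ss. Qed.

Lemma uniq_nb_walk (s : seq T) : sorted G s -> uniq s -> nb_walk s.
Proof.
rewrite /nb_walk => -> /=; elim: s => //= x s IHs /andP [xs us].
rewrite IHs // andbT; case: s xs {us IHs} => [|y [|z s]] //=.
by rewrite !inE !negb_or => /and3P [].
Qed.

(** Gluing at [y] creates at most one new turn, around [y] itself; the last hypothesis keeps this
    turn from going back. *)
Lemma nb_walk_catrev (y : T) (p q : seq T) :
  nb_walk (y :: p) -> nb_walk (y :: q) ->
  (p == [::]) || (ohead p != ohead q) -> nb_walk (catrev p (y :: q)).
Proof.
elim: p y q => //= a p IHp y q wp wq apq; apply: (IHp).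
- exact: nb_walk_behead wp.
- move: wp wq apq; rewrite /nb_walk /= => /and3P [/andP [ya _] _ _].
  by case/andP=> yq nbq ->; rewrite adj_sym ya yq nbq.
- move: wp; rewrite /nb_walk /= => /and3P [_ nb _].
  by case: p nb {IHp apq} => //= b p; rewrite eq_sym.
Qed.

(** In the shortest suffix with a repetition only the head is repeated, and the stretch before its
    second occurrence is a cycle: irreflexivity and non-backtracking exclude lengths 1 and 2. *)
Lemma nb_walk_cycle (s : seq T) :
  nb_walk s -> ~~ uniq s -> exists2 c, graph_cycle G c & size c < size s.
Proof.
elim: s => //= x s IHs wxs; have ws := nb_walk_behead wxs.
case us: (uniq s); last first.
  by move=> _; case: (IHs ws (negbT us)) => c cc ltc; exists c; lia.
rewrite andbT negbK => xs; case/splitPr: xs wxs us => p1 p2 wxs us {IHs ws}.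
exists (x :: p1); last by rewrite /= size_cat /=; lia.
case/andP: wxs => /=; rewrite cat_path /= => /and3P [xp1 p1x _] nb.
rewrite /graph_cycle /= rcons_path xp1 p1x.
move: us; rewrite cat_uniq /= negb_or => /and3P [-> /andP [-> _] _].
rewrite !andbT; case: p1 nb p1x {xp1} => [|y [|z p1]] //=.
- by rewrite adj_irrefl.
- by rewrite eqxx.
Qed.

(** Once the common initial part is removed, one walk reversed and continued by the other does not
    backtrack, and it repeats a vertex because the ends coincide. *)
Lemma nb_walk_pair_cycle (y : T) (p q : seq T) :
  nb_walk (y :: p) -> nb_walk (y :: q) -> p != q -> last y p = last y q ->
  exists2 c, graph_cycle G c & size c <= size p + size q.
Proof.
elim: p y q => [|a p IHp] y q wp wq npq eql.
  case: q npq wq eql => //= b q _ wq eql.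
  case: (nb_walk_cycle wq); first by rewrite /= {1}eql mem_last.
  by move=> c cc ltc; exists c.
case: (boolP (ohead (a :: p) == ohead q)) => [|ne].
  case: q npq wq eql => //= b q npq wq eql /eqP [eab]; subst b.
  have npq' : p != q by apply: contraNneq npq => ->.
  case: (IHp a q (nb_walk_behead wp) (nb_walk_behead wq) npq' eql) => c cc lec.
  by exists c => //; lia.
have ww := nb_walk_catrev wp wq ne.
case: (nb_walk_cycle ww).
  rewrite catrevE cat_uniq !negb_and negbK; apply/orP; right.
  apply/orP; left; apply/hasP; exists (last y q); first exact: mem_last.
  by have := mem_last a p; rewrite -mem_rev /= -eql.
move=> c cc; rewrite catrevE size_cat size_rev /= => ltc.
by exists c => //=; lia.
Qed.

(** The branch at [b] of the Moore tree of the edge [ab], with [k] levels: a node is the tail, after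
    [a] and [b], of a non-backtracking walk. *)
Fixpoint nb_tree (k : nat) (a b : T) : seq (seq T) :=
  if k is k'.+1 then
    [::] :: [seq c :: p | c <- enum [set c | G b c & c != a],
                          p <- nb_tree k' b c]
  else [::].

Lemma mem_nb_tree (k : nat) (a b : T) (p : seq T) :
  G a b -> p \in nb_tree k a b -> nb_walk [:: a, b & p] /\ size p < k.
Proof.
elim: k a b p => //= k IHk a b p ab; rewrite inE => /predU1P [->|].
  by rewrite /nb_walk /= ab.
case/allpairsPdep=> c [q [+ + ->]].
rewrite mem_enum inE => /andP [bc nca] /(IHk _ _ _ bc) [wq ltq].
split=> //; move: wq; rewrite /nb_walk /= ab bc => /andP [->] nb.
by rewrite (inj_eq Some_inj) eq_sym nca.
Qed.

Lemma nb_tree_uniq (k : nat) (a b : T) : uniq (nb_tree k a b).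
Proof.
elim: k a b => //= k IHk a b; apply/andP; split.
  by apply/negP=> /allpairsPdep [c [q [_ _ ]]].
apply: allpairs_uniq_dep; rewrite ?enum_uniq //.
by move=> [c p] [c' p'] _ _ /= [<- <-].
Qed.

Lemma size_nb_tree (r k : nat) (a b : T) : regular r G -> G a b ->
  size (nb_tree k a b) = \sum_(0 <= i < k) (r - 1) ^ i.
Proof.
move=> rG; elim: k a b => [|k IHk] a b ab /=; first by rewrite big_geq.
rewrite size_allpairs_dep big_nat_recl // expn0 add1n; congr _.+1.
rewrite sumnE big_map.
rewrite (eq_big_seq (fun=> \sum_(0 <= i < k) (r - 1) ^ i)); last first.
  by move=> c; rewrite mem_enum inE => /andP [bc _]; apply: IHk.
rewrite big_const_seq count_predT iter_addn_0 -cardE.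
have -> : #|[set c | G b c & c != a]| = r - 1.
  rewrite -(rG b) (cardsD1 a [set y | G b y]) inE adj_sym ab add1n subn1 /=.
  by apply: eq_card => c; rewrite !inE andbC.
by rewrite mulnC big_distrr /=; apply: eq_bigr => i _; rewrite expnS.
Qed.

End Walks.

(** * Graphs meeting the Moore bound *)

Section Moore.

Variables (T : finType) (G : sgraph T) (r m : nat).
Hypothesis rG : regular r G.
Hypothesis girthG : forall c, graph_cycle G c -> 2 * m <= size c.

(** Below the girth a graph looks like a tree: two distinct walks would close up to a cycle that is
    too short. *)
Lemma nb_walk_unique (y : T) (p q : seq T) :
  nb_walk G (y :: p) -> nb_walk G (y :: q) -> last y p = last y q ->
  size p + size q < 2 * m -> p = q.
Proof.
move=> wp wq eql lt; apply/eqP/negPn/negP => npq.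
have [c /girthG] := nb_walk_pair_cycle wp wq npq eql.
by lia.
Qed.

(* The walks leaving the edge uv on either side have pairwise distinct ends, *)
(* and there are as many of them as vertices.                                *)
Lemma moore_reach (u v w : T) :
  #|T| = 2 * \sum_(0 <= i < m) (r - 1) ^ i -> G u v ->
  (exists p, [/\ nb_walk G [:: v, u & p], size p < m & last u p = w]) \/
  (exists p, [/\ nb_walk G [:: u, v & p], size p < m & last v p = w]).
Proof.
move=> cT uv; have vu : G v u by rewrite adj_sym.
pose E1 := [seq last u p | p <- nb_tree G m v u].
pose E2 := [seq last v p | p <- nb_tree G m u v].
have uE : uniq (E1 ++ E2).
  rewrite cat_uniq !map_inj_in_uniq ?nb_tree_uniq /= ?andbT.
  - apply/hasPn=> _ /mapP [q /(mem_nb_tree uv) [wq ltq] ->].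
    apply/mapP=> -[p /(mem_nb_tree vu) [wp ltp] eql].
    (* Both are walks from [u] to the same end, of lengths at most [m - 1] and [m]. Their equality
       is absurd, as [p] may not return to [v] at once. *)
    have epq : p = v :: q.
      by apply: (nb_walk_unique (nb_walk_behead wp) wq) => //=; lia.
    by move: wp; rewrite epq /nb_walk /= eqxx andbF.
  - move=> p q /(mem_nb_tree uv) [wp ltp] /(mem_nb_tree uv) [wq ltq] eql.
    apply: nb_walk_unique (nb_walk_behead wp) (nb_walk_behead wq) eql _; lia.
  - move=> p q /(mem_nb_tree vu) [wp ltp] /(mem_nb_tree vu) [wq ltq] eql.
    apply: nb_walk_unique (nb_walk_behead wp) (nb_walk_behead wq) eql _; lia.
have : w \in E1 ++ E2.
  have [] // := @uniq_min_size _ (E1 ++ E2) (enum T) uE.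
  - by move=> x _; rewrite mem_enum.
  - rewrite -cardE size_cat !size_map (size_nb_tree _ rG vu).
    by rewrite (size_nb_tree _ rG uv) cT; lia.
  - by move=> _ ->; rewrite mem_enum.
rewrite mem_cat => /orP [] /mapP [p pt ->]; [left|right]; exists p.
  by have [] := mem_nb_tree vu pt.
by have [] := mem_nb_tree uv pt.
Qed.

(* The walk from the first edge to the end of the path cannot start at v,    *)
(* where it would duplicate a path of length m; starting at u, it has length *)
(* at most m - 1 and closes the path up.                                     *)
Lemma moore_path_cycle (u : T) (l : seq T) :
  #|T| = 2 * \sum_(0 <= i < m) (r - 1) ^ i ->
  path G u l -> uniq (u :: l) -> size l = m.+1 ->
  exists s, graph_cycle G ((u :: l) ++ s) /\ size s < m.-1.
Proof.
move=> cT; case: l => // v l pl ul [sl].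
have wl := uniq_nb_walk (s := [:: u, v & l]) pl ul.
have uv : G u v by case/andP: pl.
case: (moore_reach (last v l) cT uv) => -[p [wp ltp lp]]; last first.
  have epl : p = l.
    apply: nb_walk_unique (nb_walk_behead wp) (nb_walk_behead wl) lp _.
    by lia.
  by move: ltp; rewrite epl sl ltnn.
have wup := nb_walk_behead wp.
have hp : ohead p != Some v.
  case: p wp {ltp lp wup} => //= a p; rewrite /nb_walk /= => /and3P [_ + _].
  by rewrite eq_sym.
have ww : nb_walk G (catrev p [:: u, v & l]).
  by apply: nb_walk_catrev => //; rewrite hp orbT.
case/lastP: p => [|p w] in ltp lp wup hp ww wp *.
  by case/andP: ul; rewrite [u in u \notin _]lp /= mem_last.
move: lp ltp ww; rewrite last_rcons size_rcons catrevE rev_rcons => -> ltp ww.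
(* The far end of the walk is the end of the path and is already dropped, which leaves at most
   [m - 2] new vertices. *)
exists (rev p); split; last by rewrite size_rev; lia.
have wc := nb_walk_behead ww.
rewrite /graph_cycle -(rot_uniq (size [:: u, v & l])).
rewrite -(rot_cycle (size [:: u, v & l])) rot_size_cat size_cat /=.
apply/and3P; split; first by lia.
  (* A repetition among these at most [(m - 2) + (m + 2)] vertices would give a cycle of length
     below [2 * m]. *)
  apply/negPn/negP => /(nb_walk_cycle wc) [c /girthG].
  by rewrite size_cat size_rev /=; lia.
move: ww; rewrite /nb_walk /= => /andP [+ _].
case: (rev p) => [|z s] /=; first by rewrite rcons_path => /and3P [-> -> ->].
by rewrite rcons_path last_cat /= => /andP [-> ->].
Qed.

End Moore.

(** * The wgraph of a Hamiltonian cycle *)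

Lemma next_neq_prev (T : eqType) (c : seq T) (x : T) :
  2 < size c -> uniq c -> x \in c -> next c x != prev c x.
Proof.
move=> sc uc /rot_to [i s es].
rewrite -(next_rot i uc) -(prev_rot i uc).
move: sc uc; rewrite -(size_rot i) -(rot_uniq i) es.
case: s {es} => [|y [|z s]] // _ /andP [nx /andP [ny _]].
rewrite prev_nth mem_head (memNindex nx) /= eqxx.
by apply: contraNneq ny => {1}->; apply: (mem_nth x (s := z :: s)).
Qed.

Section Hamilton.

Variables (T : finType) (G : sgraph T) (h : seq T).

(** [next h] fixes the vertices off [h], so this relation may have loops; intersecting it with [G]
    removes them, whatever [h] is. *)
Definition on_cycle : rel T := [rel x y | (y == next h x) || (x == next h y)].

Lemma on_cycle_sym : symmetric on_cycle.
Proof. by move=> x y; apply: orbC. Qed.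

Lemma light_sym : symmetric [rel x y | G x y && on_cycle x y].
Proof. by move=> x y; rewrite /= adj_sym on_cycle_sym. Qed.

Lemma light_irrefl : irreflexive [rel x y | G x y && on_cycle x y].
Proof. by move=> x; rewrite /= adj_irrefl. Qed.

Lemma heavy_sym : symmetric [rel x y | G x y && ~~ on_cycle x y].
Proof. by move=> x y; rewrite /= adj_sym on_cycle_sym. Qed.

Lemma heavy_irrefl : irreflexive [rel x y | G x y && ~~ on_cycle x y].
Proof. by move=> x; rewrite /= adj_irrefl. Qed.

Lemma cycle_wgraph_disjoint x y :
  ~~ (SGraph light_sym light_irrefl x y && SGraph heavy_sym heavy_irrefl x y).
Proof. by rewrite /=; case: (G x y); case: (on_cycle _ _). Qed.

Definition cycle_wgraph : wgraph T := WGraph cycle_wgraph_disjoint.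

Lemma wadj_cycle_wgraph x y : wadj cycle_wgraph x y = G x y.
Proof. by rewrite /wadj /=; case: (G x y); case: (on_cycle _ _). Qed.

Lemma wcycle_cycle_wgraph c : wcycle cycle_wgraph c = graph_cycle G c.
Proof. by rewrite /wcycle /graph_cycle (eq_cycle wadj_cycle_wgraph). Qed.

Lemma wcycle_weightE c : graph_cycle G c ->
  wcycle_weight cycle_wgraph c
  = size c + \sum_(x <- c) ~~ on_cycle x (next c x).
Proof.
case/and3P=> _ _ cc; rewrite -sum1_size -big_split /=.
apply: eq_big_seq => x xc; rewrite /= (next_cycle cc xc).
by case: (on_cycle _ _).
Qed.

(** The edges along [l] are light; each of the [size s + 1] remaining ones is charged as if
    heavy. *)
Lemma wcycle_weight_le u l s :
  graph_cycle G (u :: l ++ s) -> path on_cycle u l ->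
  wcycle_weight cycle_wgraph (u :: l ++ s)
  <= size (u :: l ++ s) + (size s).+1.
Proof.
move=> cc pl; rewrite wcycle_weightE // leq_add2l.
case/and3P: cc => _ uc _; set c := u :: l ++ s in uc *.
pose F x : nat := ~~ on_cycle x (next c x).
rewrite -[X in X <= _]/(\sum_(x <- c) F x) -(cat_take_drop (size l) c).
rewrite big_cat /= big_seq big1 ?add0n.
  apply: (@leq_trans (\sum_(x <- drop (size l) c) 1)).
    by apply: leq_sum => x _; apply: leq_b1.
  by rewrite sum1_size size_drop /= size_cat; lia.
move=> x /(nthP u) [i]; rewrite size_takel /= ?size_cat; last by lia.
move=> il; rewrite nth_take // => <-; rewrite /F.
have ic : i < size c by rewrite /= size_cat; lia.
rewrite next_nth mem_nth // index_uniq //= nth_cat il /c -cat_cons nth_cat /=.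
by rewrite ltnS (ltnW il); have /(pathP u)/(_ i il) -> := pl.
Qed.

Hypothesis hh : graph_cycle G h.
Hypothesis hamh : forall x, x \in h.

Lemma on_cycleE x y : on_cycle x y = (y \in [set next h x; prev h x]).
Proof.
case/and3P: hh => _ uh _; rewrite /= !inE; congr (_ || _).
by rewrite -(can2_eq (prev_next uh) (next_prev uh)) eq_sym.
Qed.

Lemma on_cycle_adj : subrel on_cycle G.
Proof.
case/and3P: hh => _ _ ch x y /orP [] /eqP ->; first exact: next_cycle.
by rewrite adj_sym; apply: next_cycle.
Qed.

Lemma cycle_wgraph_regular r : regular r G -> wregular 2 (r - 2) cycle_wgraph.
Proof.
case/and3P: hh => sh uh _ rG.
have c2 x : #|[set y | on_cycle x y]| = 2.
  rewrite (@eq_card _ _ (mem [set next h x; prev h x])).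
    by rewrite cards2 next_neq_prev.
  by move=> y; rewrite inE on_cycleE.
split=> x.
  rewrite -(c2 x); apply: eq_card => y; rewrite !inE /= andb_idl //.
  exact: on_cycle_adj.
rewrite -(rG x) -(c2 x) -cardsDS.
  by apply: eq_card => y; rewrite !inE andbC.
by apply/fintype.subsetP => y; rewrite !inE; apply: on_cycle_adj.
Qed.

(** One heavy edge already pushes the weight above the length. Without any, [c] is closed under
    [next h], hence passes through all vertices. *)
Lemma wcycle_weight_gt g c : g < #|T| -> graph_cycle G c -> g <= size c ->
  g < wcycle_weight cycle_wgraph c.
Proof.
move=> gT cc gc; rewrite wcycle_weightE //.
case: (posnP (\sum_(x <- c) ~~ on_cycle x (next c x))) => [w0|]; last by lia.
rewrite w0 addn0; apply: (leq_trans gT).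
have lc x : x \in c -> on_cycle x (next c x).
  move=> xc; move/eqP: w0; rewrite sum_nat_seq_eq0 => /allP /(_ _ xc).
  by rewrite eqb0 negbK.
case/and3P: cc => sc uc ccG; case/and3P: hh => sh uh ch.
(* The two neighbours of [x] along [c] are distinct and lie among its two neighbours along [h], so
   one of them is [next h x]. *)
have nc x : x \in c -> next h x \in c.
  move=> xc.
  have xn : next c x \in [set next h x; prev h x] by rewrite -on_cycleE lc.
  have xp : prev c x \in [set next h x; prev h x].
    rewrite -on_cycleE on_cycle_sym -{2}(next_prev uc x) lc //.
    by rewrite mem_prev.
  move: xn xp (next_neq_prev sc uc xc).
  rewrite !inE => /orP [] /eqP en /orP [] /eqP ep.
  - by rewrite en ep eqxx.
  - by rewrite -en mem_next.
  - by rewrite -ep mem_prev.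
  - by rewrite en ep eqxx.
have [x0 x0c] : exists x, x \in c.
  by case: (c) sc => // x *; exists x; rewrite mem_head.
rewrite cardE; apply: uniq_leq_size; first exact: enum_uniq.
move=> y _; have /iter_findex <- : fconnect (next h) x0 y.
  by rewrite (fconnect_cycle (cycle_next uh)).
by elim: (findex _ _ _) => //= n IHn; apply: nc.
Qed.

End Hamilton.

(** * The bounds on the girth and the order *)

(** All terms of the sum but the first are at least 2, so with [g' = 2m] it doubles to at least
    [4m - 2], and [m >= 2]. *)
Lemma n0_gt r g' : 3 <= r -> 3 <= g' -> ~~ odd g' -> g' < n0 r g'.
Proof.
move=> hr hg og; rewrite /n0.
have [k ek] : exists k, g'./2 = k.+2 by exists (g'./2 - 2); lia.
have eg : g' = k.+2 * 2 by lia.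
rewrite ek eg big_nat_recl // expn0.
have : \sum_(0 <= i < k.+1) 2 <= \sum_(0 <= i < k.+1) (r - 1) ^ i.+1.
  apply: leq_sum => i _; rewrite expnS.
  have := expn_gt0 (r - 1) i; nia.
by rewrite sum_nat_const_nat; lia.
Qed.

Theorem theorem19 (r g' : nat) (hr : 3 <= r) (hg' : ~~ odd g')
  (hG : exists (T : finType) (G : sgraph T),
      [/\ regular r G, girth G = (Posz g')%:E, hamiltonian G
        & #|T| = n0 r g']) :
  exists g : nat,
    [/\ g' + 1 <= g, g <= 3 * g'./2 - 1
      & (min_order 2 (r - 2) g <= (Posz (n0 r g'))%:E)%E].
Proof.
case: hG => T [G [rG gG [h hh hamh] cT]].
have [[c0 c0c sc0] ming] := min_nat_fin gG.
have girth_le c : graph_cycle G c -> g' <= size c.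
  by move=> cc; apply: ming; exists c.
have g3 : 2 < g' by rewrite -sc0; case/and3P: c0c.
have ltn0 := n0_gt hr g3 hg'.
set m := g'./2; have g2 : g' = 2 * m by rewrite /m; lia.
have sh : g' < size h.
  apply: (leq_trans ltn0); rewrite -cT cardE; apply: uniq_leq_size.
    exact: enum_uniq.
  by move=> x _; apply: hamh.
(* More than [2 * m] vertices on [h], with [m >= 2], leave room for [m + 2] consecutive distinct
   ones. *)
have [u [l [pl ul sl]]] :
    exists u l, [/\ path (on_cycle h) u l, uniq (u :: l) & size l = m.+1].
  case/and3P: hh => _ uh _; have := cycle_next uh.
  case: h {hamh} sh uh => // u h' /= sh uh; rewrite rcons_path => /andP [ph _].
  exists u, (take m.+1 h'); split; last by rewrite size_takel //; lia.
    apply: take_path; apply: sub_path ph => x y /= /eqP <-.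
    by rewrite /on_cycle /= eqxx.
  by have := take_uniq m.+2 (s := u :: h') uh.
have [s [cs ss]] : exists s, graph_cycle G ((u :: l) ++ s) /\ size s < m.-1.
  apply: (moore_path_cycle rG) => //.
  - by move=> c /girth_le; rewrite g2.
  - by apply: sub_path pl; apply: on_cycle_adj.
pose W := cycle_wgraph G h.
(* [g] is the girth of [W]; the cycle just built shows that it is finite and bounds it from
   above. *)
have [g [wg [c cc wc] gle]] := @min_nat_attained
  [set w | exists2 c, wcycle W c & wcycle_weight W c = w]
  (wcycle_weight W (u :: l ++ s))
  (ex_intro2 _ _ (u :: l ++ s) (etrans (wcycle_cycle_wgraph _ _ _) cs) erefl).
rewrite wcycle_cycle_wgraph in cc.
exists g; split.
- rewrite addn1 -wc; apply: wcycle_weight_gt => //; first by rewrite cT.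
  exact: girth_le.
(* Length at most [2 * m] and at most [m - 1] heavy edges. *)
- have := wcycle_weight_le cs pl; rewrite -/W /= size_cat sl => le.
  by apply: (leq_trans gle); apply: (leq_trans le); lia.
rewrite /min_order.
have [] := @min_nat_attained
  [set n | exists (T : finType) (G : wgraph T),
             abg_wgraph 2 (r - 2) g G /\ #|T| = n] (n0 r g').
  by exists T, W; split=> //; split=> //; apply: cycle_wgraph_regular.
by move=> n [-> _ len]; rewrite lee_fin lez_nat.
Qed.
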